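(* Let $n\ge2$, let $\mathbf{q}=(\mathbf{q}_1,\dots,\mathbf{q}_n)$ be an $n$-body configuration with masses $m_1,\dots,m_n$ and center of mass $c$, and let $\bar{\mathbf{q}}=(\mathbf{q}_0,\mathbf{q}_1,\dots,\mathbf{q}_n)$ be the $(n+1)$-body configuration obtained by adding a mass $m_0$ at $\mathbf{q}_0$. Suppose that $\mathbf{q}_0=c$. Then both $\bar{\mathbf{q}}$ and $\mathbf{q}$ are central if and only if the following two conditions hold: (i) $\mathbf{q}$ is central; (ii) $|\mathbf{q}_1-\mathbf{q}_0|=|\mathbf{q}_2-\mathbf{q}_0|=\dots=|\mathbf{q}_n-\mathbf{q}_0|$.
   Context: All configurations are in $\mathbb{R}^3$, all masses are positive, and the bodies of a configuration occupy pairwise distinct positions. For bodies with masses $m_1,\dots,m_k$ at $\mathbf{q}_1,\dots,\mathbf{q}_k$ ($k\ge2$) put $m=\sum_i m_i$, $c=\frac1m\sum_i m_i\mathbf{q}_i$, $U=\sum_{i<j}\frac{m_im_j}{|\mathbf{q}_i-\mathbf{q}_j|}$, $I=\sum_i m_i|\mathbf{q}_i-c|^2$. The configuration is central if $\nabla U+\frac{\lambda}{2}\nabla I=0$ with $\lambda=U/I$, i.e. $\sum_{j\ne i} m_im_j\frac{\mathbf{q}_j-\mathbf{q}_i}{|\mathbf{q}_j-\mathbf{q}_i|^3}=-\lambda m_i(\mathbf{q}_i-c)$ for all $i$. *)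

(* Defs.v *)
From mathcomp Require Import all_boot all_order all_algebra.
From mathcomp Require Import reals.

Set Implicit Arguments.
Unset Strict Implicit.
Unset Printing Implicit Defensive.

Import Order.TTheory GRing.Theory Num.Theory.
Local Open Scope ring_scope.

(* The Euclidean norm; the norm that MathComp-Analysis puts on row vectors is
   the sup norm. *)
Definition enorm (R : realType) (d : nat) (v : 'rV[R]_d) : R :=
  Num.sqrt (\sum_(l < d) v 0 l ^+ 2).

Section Configurations.
Variables (R : realType) (k : nat).
Variables (m : 'I_k -> R) (q : 'I_k -> 'rV[R]_3).

Definition total_mass : R := \sum_i m i.

Definition center_of_mass : 'rV[R]_3 := total_mass^-1 *: \sum_i m i *: q i.

Definition potential : R :=
  \sum_(i < k) \sum_(j < k | (i < j)%N) m i * m j / enorm (q i - q j).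

Definition moment_of_inertia : R :=
  \sum_i m i * enorm (q i - center_of_mass) ^+ 2.

(* The equation grad U + (lambda / 2) grad I = 0, with lambda = U / I, written
   body by body. Meaningful for k >= 2, positive masses and injective q. *)
Definition central : Prop :=
  forall i : 'I_k,
    \sum_(j < k | j != i)
      (m i * m j / enorm (q j - q i) ^+ 3) *: (q j - q i) =
    - ((potential / moment_of_inertia * m i) *: (q i - center_of_mass)).

End Configurations.

(* The family (x0, x_1, ..., x_n): x0 at index 0, and x shifted by one. *)
Definition adjoin (T : Type) (n : nat) (x0 : T) (x : 'I_n -> T) :
    'I_n.+1 -> T :=
  fun i => if unlift ord0 i is Some j then x j else x0.

(* Main.v *)
Require Import Defs.
From mathcomp Require Import all_boot all_order all_algebra.
From mathcomp Require Import reals.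
From mathcomp Require Import ring.
Import Order.TTheory GRing.Theory Num.Theory.
Local Open Scope ring_scope.

(** Write r_i for [enorm (q i - q0)] and M for [total_mass m]. A mass placed at the center of mass
    changes neither that center nor the moment of inertia, and it pulls body i along q_i - q0, the
    direction in which a central configuration already pulls it. So if [q] is central, the equation
    of body i in the enlarged configuration is the scalar equation m0 / r_i^3 = [lambdab - lambda]
    ([central_adjoin_body_equation]). The right side does not depend on i, so all r_i agree.
    Conversely, if every r_i equals r, then I = M r^2 and the potential grows by m0 M / r, so
    [lambdab - lambda] is exactly m0 / r^3 and the old bodies satisfy their equations. The force on
    the added body is then a multiple of the sum of the m_i (q_i - q0), which vanishes. *)

Lemma enorm_ge0 (R : realType) d (v : 'rV[R]_d) : 0 <= enorm v.
Proof. exact: sqrtr_ge0. Qed.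

Lemma enormN (R : realType) d (v : 'rV[R]_d) : enorm (- v) = enorm v.
Proof. by rewrite /enorm; under eq_bigr => l _ do rewrite mxE sqrrN. Qed.

Lemma enormB (R : realType) d (u v : 'rV[R]_d) : enorm (u - v) = enorm (v - u).
Proof. by rewrite -enormN opprB. Qed.

Lemma enorm0 (R : realType) d : enorm (0 : 'rV[R]_d) = 0.
Proof.
by rewrite /enorm big1 ?sqrtr0 // => l _; rewrite mxE expr0n.
Qed.

Lemma enorm_gt0 (R : realType) d (v : 'rV[R]_d) : v != 0 -> 0 < enorm v.
Proof.
move=> v_neq0; rewrite sqrtr_gt0 lt_def sumr_ge0 ?andbT; last first.
  by move=> l _; exact: sqr_ge0.
apply: contra v_neq0; rewrite psumr_eq0; last by move=> l _; exact: sqr_ge0.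
move=> /allP v0; apply/eqP/rowP => l; rewrite mxE; apply/eqP.
by rewrite -sqrf_eq0; apply: v0; rewrite mem_index_enum.
Qed.

Lemma adjoin0 T n (x0 : T) (x : 'I_n -> T) : adjoin x0 x ord0 = x0.
Proof. by rewrite /adjoin unlift_none. Qed.

Lemma adjoin_lift T n (x0 : T) (x : 'I_n -> T) i :
  adjoin x0 x (lift ord0 i) = x i.
Proof. by rewrite /adjoin liftK. Qed.

Section AddCentralBody.
Variables (R : realType) (n : nat) (m0 : R) (m : 'I_n -> R).
Variables (q0 : 'rV[R]_3) (q : 'I_n -> 'rV[R]_3).
Hypothesis n_gt0 : (0 < n)%N.
Hypothesis m0_gt0 : 0 < m0.
Hypothesis m_gt0 : forall i, 0 < m i.
Hypothesis q0_center : q0 = center_of_mass m q.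
Hypothesis q_neq0 : forall i, q i - q0 != 0.

Let mb := adjoin m0 m.
Let qb := adjoin q0 q.

Lemma total_mass_gt0 : 0 < total_mass m.
Proof.
rewrite /total_mass (bigD1 (Ordinal n_gt0)) //= ltr_pwDl ?m_gt0 //.
by apply: sumr_ge0 => i _; exact: ltW.
Qed.

Lemma sum_mass_position : \sum_i m i *: q i = total_mass m *: q0.
Proof.
by rewrite q0_center /center_of_mass scalerA divff ?scale1r ?gt_eqF
  ?total_mass_gt0.
Qed.

Lemma sum_mass_relative_position : \sum_i m i *: (q i - q0) = 0.
Proof.
under eq_bigr => i _ do rewrite scalerBr.
by rewrite sumrB sum_mass_position -scaler_suml subrr.
Qed.

Lemma center_of_mass_adjoin : center_of_mass mb qb = q0.
Proof.
rewrite /center_of_mass /total_mass !big_ord_recl /mb /qb !adjoin0.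
under eq_bigr => i _ do rewrite adjoin_lift.
under [X in _ *: (_ + X)]eq_bigr => i _ do rewrite !adjoin_lift.
rewrite sum_mass_position -scalerDl scalerA mulVf ?scale1r //.
by rewrite gt_eqF // addr_gt0 // total_mass_gt0.
Qed.

Lemma moment_of_inertia_adjoin :
  moment_of_inertia mb qb = moment_of_inertia m q.
Proof.
rewrite /moment_of_inertia center_of_mass_adjoin -q0_center big_ord_recl.
rewrite /mb /qb !adjoin0 subrr enorm0 expr0n mulr0 add0r.
by apply: eq_bigr => i _; rewrite !adjoin_lift.
Qed.

(** The pairs containing the added body, whose index 0 is the least, all lie in row 0 of the double
    sum; the other rows reproduce the old potential with indices shifted by one. *)
Lemma potential_adjoin :
  potential mb qb = m0 * (\sum_i m i / enorm (q i - q0)) + potential m q.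
Proof.
rewrite /potential big_ord_recl; congr (_ + _).
  rewrite big_mkcond big_ord_recl /= add0r mulr_sumr.
  by apply: eq_bigr => i _; rewrite /mb /qb !adjoin0 !adjoin_lift enormB mulrA.
apply: eq_bigr => i _; rewrite big_mkcond big_ord_recl /= add0r -big_mkcond /=.
by apply: eq_big => [j|j _]; rewrite /mb /qb ?adjoin_lift // /bump /= !add1n ltnS.
Qed.

Lemma force_on_added_body :
  \sum_(j < n.+1 | j != ord0)
    (mb ord0 * mb j / enorm (qb j - qb ord0) ^+ 3) *: (qb j - qb ord0) =
  \sum_i (m0 * m i / enorm (q i - q0) ^+ 3) *: (q i - q0).
Proof.
rewrite big_mkcond big_ord_recl /= add0r; apply: eq_bigr => i _.
by rewrite /mb /qb !adjoin0 !adjoin_lift.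
Qed.

Lemma force_adjoin i :
  \sum_(j < n.+1 | j != lift ord0 i)
    (mb (lift ord0 i) * mb j / enorm (qb j - qb (lift ord0 i)) ^+ 3) *:
      (qb j - qb (lift ord0 i)) =
  - ((m i * m0 / enorm (q i - q0) ^+ 3) *: (q i - q0)) +
  \sum_(j < n | j != i)
    (m i * m j / enorm (q j - q i) ^+ 3) *: (q j - q i).
Proof.
rewrite big_mkcond big_ord_recl /= -big_mkcond /=; congr (_ + _).
  by rewrite /mb /qb !adjoin0 !adjoin_lift enormB -scalerN opprB.
by apply: eq_big => [j|j _]; rewrite /mb /qb ?adjoin_lift ?(inj_eq lift_inj).
Qed.

Let lambda := potential m q / moment_of_inertia m q.
Let lambdab := potential mb qb / moment_of_inertia mb qb.

(** Centrality of [q] replaces the pull of the other old bodies by -[lambda] m_i (q_i - q0). Every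
    term is then a multiple of the nonzero vector q_i - q0, and m_i > 0 cancels. *)
Lemma central_adjoin_body_equation i : central m q ->
  \sum_(j < n.+1 | j != lift ord0 i)
    (mb (lift ord0 i) * mb j / enorm (qb j - qb (lift ord0 i)) ^+ 3) *:
      (qb j - qb (lift ord0 i)) =
  - ((lambdab * mb (lift ord0 i)) *:
       (qb (lift ord0 i) - center_of_mass mb qb)) <->
  m0 / enorm (q i - q0) ^+ 3 = lambdab - lambda.
Proof.
move=> qC; rewrite force_adjoin (qC i) -q0_center -/lambda.
rewrite center_of_mass_adjoin /mb /qb !adjoin_lift -/mb -/qb.
rewrite -opprD -scalerDl -mulrA [_ * m i]mulrC -mulrDr [lambdab * _]mulrC.
split=> [/oppr_inj/eqP|->]; last by rewrite subrK.
rewrite -subr_eq0 -scalerBl scaler_eq0 (negbTE (q_neq0 i)) orbF subr_eq0.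
move=> /eqP/(mulfI (lt0r_neq0 (m_gt0 i))) <-.
by rewrite addrK.
Qed.

Lemma central_adjoin_equidistant i j :
  central mb qb -> central m q -> enorm (q i - q0) = enorm (q j - q0).
Proof.
move=> qbC qC.
have rE k : m0 / enorm (q k - q0) ^+ 3 = lambdab - lambda.
  by apply/central_adjoin_body_equation => //; exact: qbC.
(* Distances are nonnegative, so it suffices to compare their cubes, and hence m0 divided by these
   cubes. *)
apply: (@pexpIrn _ 3) => //; rewrite ?nnegrE ?enorm_ge0 //.
apply/invr_inj/(mulfI (lt0r_neq0 m0_gt0)).
by rewrite rE rE.
Qed.

Lemma equidistant_central_adjoin :
  central m q -> (forall i j, enorm (q i - q0) = enorm (q j - q0)) ->
  central mb qb.
Proof.
move=> qC eq_r; set r := enorm (q (Ordinal n_gt0) - q0).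
have rE i : enorm (q i - q0) = r by exact: eq_r.
have r_neq0 : r != 0 by rewrite gt_eqF // enorm_gt0.
have M_neq0 : total_mass m != 0 by rewrite gt_eqF // total_mass_gt0.
have IE : moment_of_inertia m q = total_mass m * r ^+ 2.
  rewrite /moment_of_inertia -q0_center mulr_suml.
  by apply: eq_bigr => i _; rewrite rE.
have UE : potential mb qb = m0 * (total_mass m / r) + potential m q.
  rewrite potential_adjoin [in RHS]mulr_suml.
  by congr (m0 * _ + _); apply: eq_bigr => i _; rewrite rE.
(* Both multipliers have the same denominator M r^2, so their difference is (m0 M / r) / (M r^2). *)
have dlE : m0 / r ^+ 3 = lambdab - lambda.
  rewrite /lambdab /lambda moment_of_inertia_adjoin IE UE.
  by field; rewrite r_neq0 M_neq0.
move=> i; case: (unliftP ord0 i) => [j ->|->].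
  by apply/central_adjoin_body_equation => //; rewrite rE.
(* The added body sits at the center of mass, so its equation asks for zero total force; the equal
   distances let m0 / r^3 factor out. *)
rewrite force_on_added_body center_of_mass_adjoin [qb ord0]adjoin0 subrr scaler0.
rewrite oppr0; transitivity (m0 / r ^+ 3 *: \sum_i m i *: (q i - q0)).
  by rewrite scaler_sumr; apply: eq_bigr => j _; rewrite rE scalerA mulrAC.
by rewrite sum_mass_relative_position scaler0.
Qed.

End AddCentralBody.

Theorem theorem2 (R : realType) (n : nat) (m0 : R) (m : 'I_n -> R)
    (q0 : 'rV[R]_3) (q : 'I_n -> 'rV[R]_3)
    (n_ge2 : (2 <= n)%N)
    (m0_gt0 : 0 < m0) (m_gt0 : forall i : 'I_n, 0 < m i)
    (qbar_inj : injective (adjoin q0 q))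
    (q0_center : q0 = center_of_mass m q) :
  (central (adjoin m0 m) (adjoin q0 q) /\ central m q) <->
  (central m q /\
   forall i j : 'I_n, enorm (q i - q0) = enorm (q j - q0)).
Proof.
have n_gt0 : (0 < n)%N by exact: ltnW.
(* An old body at q0 would collide with the added one, against injectivity of the enlarged
   configuration. *)
have q_neq0 i : q i - q0 != 0.
  rewrite subr_eq0; apply/eqP => qi0.
  have /qbar_inj/eqP : adjoin q0 q (lift ord0 i) = adjoin q0 q ord0.
    by rewrite adjoin_lift adjoin0.
  by rewrite eq_sym (negbTE (neq_lift _ _)).
split=> [[qbC qC]|[qC eq_r]]; split=> //.
  by move=> i j; apply: central_adjoin_equidistant qbC qC.
exact: equidistant_central_adjoin.
Qed.
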